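(* There exist dynamic flow networks with only one capacity change in which every minimum dynamic cut and every maximum dynamic flow has exponential complexity: for every $\ell\in\mathbb{N}^+$ there is a dynamic flow network of size polynomial in $\ell$ with only one capacity change such that every minimum dynamic cut and every maximum dynamic flow has complexity at least $2^\ell$. This holds even with acyclic underlying graphs and with discrete time (all transit times, capacity change times and the time horizon being integer multiples of a common time unit, so that time may be discretized into units of that length).
   Context: A dynamic flow network with time-dependent capacities: directed graph $G=(V,E)$, source $s$, target $t$, time horizon $T$, constant transit times $\tau_e\ge0$ and capacity functions $u_e\colon[0,T]\to\mathbb{R}_{\ge0}$ with finitely many discontinuities; ''only one capacity change'' means all capacities are constant except one edge whose capacity function has a single jump. A dynamic flow is a family of measurable $f_e\colon[0,T-\tau_e]\to\mathbb{R}$ with $f_e\le u_e$ and strong flow conservation (excess $\int_0^\Theta(\sum_{e=(u,v)}f_e(\zeta-\tau_e)-\sum_{e=(v,u)}f_e(\zeta))d\zeta=0$ for all $v\ne s,t$, $\Theta\in[0,T]$); its value is the excess of $t$ at $T$. A dynamic cut is a family $S_v\colon[0,T]\to\{0,1\}$ with $S_s\equiv1$, $S_t\equiv0$ on $[0,T]$, $S_v(\Theta)=1$ for $\Theta>T$, of capacity $\int_0^T\sum_{e=(v,w):S_v(\Theta)=1,S_w(\Theta+\tau_e)=0}u_e(\Theta)d\Theta$. A vertex changes partition at $\Theta$ if $S_v(\Theta-\delta)\ne S_v(\Theta+\delta)$ for all small $\delta>0$; the complexity of a cut is the total number of partition changes over all vertices. Analogously, the complexity of a flow is the total number of changes of the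 functions $f_e$ over all edges.
   Formalization: A change at a time means not almost-everywhere constant near it (the pointwise definition is defeated by altering an optimal cut on a null set); flows are taken nonnegative, cuts measurable, and size counts vertices plus edges. *)

(* Defs.v *)
From HB Require Import structures.
From mathcomp Require Import all_boot all_order all_algebra.
From mathcomp Require Import all_classical all_reals all_analysis.
Unset Printing Implicit Defensive.
Import Order.TTheory GRing.Theory Num.Theory.
Import numFieldNormedType.Exports.
Local Open Scope classical_set_scope.
Local Open Scope ring_scope.

Record network (R : realType) := Network {
  nv : nat;
  ne : nat;
  tl : 'I_ne -> 'I_nv;
  hd : 'I_ne -> 'I_nv;
  src : 'I_nv;
  snk : 'I_nv;
  horizon : R;
  transit : 'I_ne -> R;
  cap : 'I_ne -> R -> R }.
Arguments Network {R}.
Arguments nv {R}. Arguments ne {R}. Arguments tl {R}. Arguments hd {R}.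
Arguments src {R}. Arguments snk {R}. Arguments horizon {R}.
Arguments transit {R}. Arguments cap {R}.

Unset Implicit Arguments.

Section DynFlow.
Context {R : realType}.
Variable N : network R.

Local Notation T := (horizon N).
Local Notation tau := (transit N).
Local Notation u := (cap N).

Definition valid_network : Prop :=
  src N != snk N /\ 0 <= T /\ (forall e, 0 <= tau e) /\
  (forall e x, 0 <= x <= T -> 0 <= u e x).

Definition one_capacity_change_at (e0 : 'I_(ne N)) (theta0 a b : R) : Prop :=
  0 < theta0 < T /\ a != b /\
  (forall x, u e0 x = if x < theta0 then a else b) /\
  (forall e, e != e0 -> exists c, forall x, u e x = c).

Definition acyclic_network : Prop :=
  forall (e0 : 'I_(ne N)) (p : seq 'I_(ne N)),
    path (fun e1 e2 => hd N e1 == tl N e2) e0 p -> hd N (last e0 p) != tl N e0.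

Definition integer_multiple (delta x : R) : Prop := exists k : nat, x = k%:R * delta.

(* a dynamic flow: f e is (extended by 0 outside) a measurable function on
   [0, T - tau_e] with 0 <= f_e <= u_e, satisfying strong flow conservation *)
Definition excess (f : 'I_(ne N) -> R -> R) (v : 'I_(nv N)) (Theta : R) : R :=
  \int[lebesgue_measure]_(z in `[0, Theta])
     (\sum_(e | hd N e == v) f e (z - tau e) - \sum_(e | tl N e == v) f e z).

Definition is_dyn_flow (f : 'I_(ne N) -> R -> R) : Prop :=
  (forall e, measurable_fun [set: R] (f e)) /\
  (forall e x, ~ (0 <= x <= T - tau e) -> f e x = 0) /\
  (forall e x, 0 <= x <= T - tau e -> 0 <= f e x <= u e x) /\
  (forall v, v != src N -> v != snk N ->
     forall Theta, 0 <= Theta <= T -> excess f v Theta = 0).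

Definition flow_value (f : 'I_(ne N) -> R -> R) : R := excess f (snk N) T.

Definition is_max_dyn_flow (f : 'I_(ne N) -> R -> R) : Prop :=
  is_dyn_flow f /\ forall g, is_dyn_flow g -> flow_value g <= flow_value f.

Definition is_dyn_cut (S : 'I_(nv N) -> R -> bool) : Prop :=
  (forall v, measurable [set x | S v x]) /\
  (forall x, 0 <= x <= T -> S (src N) x) /\
  (forall x, 0 <= x <= T -> ~~ S (snk N) x) /\
  (forall v x, T < x -> S v x).

Definition cut_capacity (S : 'I_(nv N) -> R -> bool) : \bar R :=
  (\int[lebesgue_measure]_(x in `[0%R, T]%classic)
     (\sum_(e | S (tl N e) x && ~~ S (hd N e) (x + tau e)) u e x)%:E)%E.

Definition is_min_dyn_cut (S : 'I_(nv N) -> R -> bool) : Prop :=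
  is_dyn_cut S /\ forall S', is_dyn_cut S' -> (cut_capacity S <= cut_capacity S')%E.

Definition locally_ae_const {X : Type} (g : R -> X) (x : R) : Prop :=
  exists2 d : R, 0 < d & exists c : X,
    lebesgue_measure [set y | x - d < y < x + d /\ g y <> c] = 0%E.

Definition cut_change (S : 'I_(nv N) -> R -> bool) (v : 'I_(nv N)) (x : R) : Prop :=
  0 < x /\ ~ locally_ae_const (S v) x.

Definition flow_change (f : 'I_(ne N) -> R -> R) (e : 'I_(ne N)) (x : R) : Prop :=
  0 < x < T - tau e /\ ~ locally_ae_const (f e) x.

Definition cut_complexity_ge (S : 'I_(nv N) -> R -> bool) (k : nat) : Prop :=
  exists s : seq ('I_(nv N) * R),
    uniq s /\ (k <= size s)%N /\ forall p, p \in s -> cut_change S p.1 p.2.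

Definition flow_complexity_ge (f : 'I_(ne N) -> R -> R) (k : nat) : Prop :=
  exists s : seq ('I_(ne N) * R),
    uniq s /\ (k <= size s)%N /\ forall p, p \in s -> flow_change f p.1 p.2.

End DynFlow.

(* Main.v *)
Require Import Defs.
From HB Require Import structures.
From mathcomp Require Import all_boot all_order all_algebra.
From mathcomp Require Import all_classical all_reals all_analysis.
From mathcomp Require Import measurable_realfun zify ring lra.
Set Implicit Arguments.
Unset Strict Implicit.
Unset Printing Implicit Defensive.
Import Order.TTheory GRing.Theory Num.Theory.
Import numFieldNormedType.Exports.
Local Open Scope classical_set_scope.
Local Open Scope ring_scope.

(* The capacity of a dynamic cut minus the value of a dynamic flow is the
   integral over the horizon of the slack: the spare capacity of the cut edges
   plus the flow on the edges that lead back into the source side.  Hence, as in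
   linear programming, if one flow and one cut satisfy complementary slackness
   almost everywhere, then so do that flow and every minimum cut, and every
   maximum flow and that cut.
   The network is a chain s -> v_0 => v_1 => ... => v_l -> t.  The edge s -> v_0
   is open during [0, 1) only, and v_i and v_(i+1) are joined by two edges, with
   transit times 0 and 2^(i+1), so that flow can be at v_l exactly during the
   2^l pulses [2j, 2j + 1) with j < 2^l; the edge v_l -> t has capacity 1 and
   every other open edge has spare capacity.  The flow that saturates v_l -> t
   during the pulses and the cut that puts v_l on the source side during the
   pulses are complementary, so that v_l in a minimum cut and v_l -> t in a
   maximum flow have to follow the pulses too. *)

Section BoundedMeasurable.
Context {d} {X : measurableType d} {R : realType}.
Implicit Types (f g : X -> R) (p q : X -> bool).

Definition bounded_mfun g : Prop :=
  measurable_fun [set: X] g /\ exists M, forall x, `|g x| <= M.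

Lemma bounded_mfun_cst (r : R) : bounded_mfun (fun=> r).
Proof. by split; [exact: measurable_cst | exists `|r|]. Qed.

Lemma bounded_mfunD f g : bounded_mfun f -> bounded_mfun g ->
  bounded_mfun (fun x => f x + g x).
Proof.
move=> [mf [M fM]] [mg [M' gM']]; split; first exact: measurable_funD.
by exists (M + M') => x; rewrite (le_trans (ler_normD _ _))// lerD.
Qed.

Lemma bounded_mfunB f g : bounded_mfun f -> bounded_mfun g ->
  bounded_mfun (fun x => f x - g x).
Proof.
move=> [mf [M fM]] [mg [M' gM']]; split; first exact: measurable_funB.
by exists (M + M') => x; rewrite (le_trans (ler_normB _ _))// lerD.
Qed.

Lemma bounded_mfunM f g : bounded_mfun f -> bounded_mfun g ->
  bounded_mfun (fun x => f x * g x).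
Proof.
move=> [mf [M fM]] [mg [M' gM']]; split; first exact: measurable_funM.
by exists (M * M') => x; rewrite normrM ler_pM.
Qed.

Lemma bounded_mfun_sum (I : Type) (s : seq I) (P : pred I) (F : I -> X -> R) :
  (forall i, bounded_mfun (F i)) ->
  bounded_mfun (fun x => \sum_(i <- s | P i) F i x).
Proof.
move=> bF; elim: s => [|i s IHs].
  by under eq_fun do rewrite big_nil; exact: bounded_mfun_cst.
under eq_fun do rewrite big_cons; case: (P i) => //.
exact: bounded_mfunD.
Qed.

Lemma bounded_mfun_bool p :
  measurable [set x | p x] -> bounded_mfun (fun x => (p x)%:R).
Proof.
move=> mp; split; last by exists 1 => x; case: (p x); rewrite ?normr1 ?normr0.
rewrite (_ : (fun x => _) = \1_[set x | p x]); first exact: measurable_indic.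
by apply/funext => x; rewrite indicE mem_setE.
Qed.

Lemma bounded_mfun_negb p : bounded_mfun (fun x => (p x)%:R) ->
  bounded_mfun (fun x => (~~ p x)%:R).
Proof.
move=> bp; rewrite (_ : (fun x => _) = fun x => 1 - (p x)%:R).
  by apply: bounded_mfunB => //; exact: bounded_mfun_cst.
by apply/funext => x; case: (p x); rewrite ?subrr ?subr0.
Qed.

Lemma bounded_mfun_andb p q : bounded_mfun (fun x => (p x)%:R) ->
  bounded_mfun (fun x => (q x)%:R) -> bounded_mfun (fun x => (p x && q x)%:R).
Proof.
by move=> bp bq; under eq_fun do rewrite -mulnb natrM; exact: bounded_mfunM.
Qed.

Lemma bounded_mfun_integrable (mu : {measure set X -> \bar R}) (D : set X) g :
  measurable D -> (mu D < +oo)%E -> bounded_mfun g ->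
  mu.-integrable D (EFin \o g).
Proof.
move=> mD muD [mg [M gM]]; apply: measurable_bounded_integrable => //.
  exact: measurable_funTS.
exists M; split; first exact: num_real.
by move=> y /ltW My x _ /=; exact: le_trans My.
Qed.

End BoundedMeasurable.

Lemma bounded_mfun_comp {d d'} {X : measurableType d} {Y : measurableType d'}
    {R : realType} (phi : Y -> X) (g : X -> R) :
  measurable_fun [set: Y] phi -> bounded_mfun g ->
  bounded_mfun (fun y => g (phi y)).
Proof.
by move=> mphi [mg [M gM]]; split; [exact: measurableT_comp | exists M].
Qed.

Section RealIntegral.
Context {d} {X : measurableType d} {R : realType}.
Variable mu : {measure set X -> \bar R}.
Implicit Types (D E : set X) (g : X -> R).

Lemma Rintegral_sum (I : Type) (s : seq I) (P : pred I) (F : I -> X -> R) D :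
  measurable D -> (forall i, mu.-integrable D (EFin \o F i)) ->
  \int[mu]_(x in D) (\sum_(i <- s | P i) F i x) =
  \sum_(i <- s | P i) \int[mu]_(x in D) F i x.
Proof.
move=> mD iF; rewrite /Rintegral.
under eq_integral do rewrite -sumEFin.
rewrite integral_sum// (eq_bigr (fun i => (\int[mu]_(x in D) F i x)%:E)).
  by rewrite sumEFin.
by move=> i _; rewrite /Rintegral fineK// (integrable_fin_num mD (iF i)).
Qed.

Lemma eq_Rintegral_supp D E g :
  (forall x, g x != 0 -> D x <-> E x) ->
  \int[mu]_(x in D) g x = \int[mu]_(x in E) g x.
Proof.
move=> DE; rewrite Rintegral_mkcond [RHS]Rintegral_mkcond.
apply: eq_Rintegral => x _; rewrite !patchE.
have [->|/DE DEx] := eqVneq (g x) 0; first by rewrite !if_same.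
suff -> : (x \in D) = (x \in E) by [].
by apply/idP/idP; rewrite !inE => /DEx.
Qed.

Lemma ae_eq0_Rintegral D g : measurable D -> measurable_fun D g ->
  {ae mu, forall x, D x -> g x = 0} -> \int[mu]_(x in D) g x = 0.
Proof.
move=> mD mg g0; rewrite /Rintegral (ae_eq_integral (cst 0%E)) ?integral0//.
  exact/measurable_EFinP.
by apply: filterS g0 => x /[apply] ->.
Qed.

Lemma Rintegral_eq0_ae D g : measurable D -> mu.-integrable D (EFin \o g) ->
  {ae mu, forall x, D x -> 0 <= g x} -> \int[mu]_(x in D) g x = 0 ->
  {ae mu, forall x, D x -> g x = 0}.
Proof.
move=> mD ig g0 ig0; have mg := measurable_int _ ig.
have /(ae_eq_integral_abs mu mD mg) : (\int[mu]_(x in D) `|(g x)%:E| = 0)%E.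
  rewrite (ae_eq_integral (EFin \o g))//; last 2 first.
  - exact: measurableT_comp.
  - by apply: filterS g0 => x /[apply] gx; rewrite /= ger0_norm.
  rewrite -(fineK (integrable_fin_num mD ig)).
  by rewrite -[fine _]/(Rintegral _ _ _) ig0.
by apply: filterS => x /[apply] -[].
Qed.

End RealIntegral.

#[local] Instance lebesgue_ae_filter (R : realType) :
  Filter (nbhs (almost_everywhere (@lebesgue_measure R))).
Proof. exact: (ae_filter_ringOfSetsType lebesgue_measure). Qed.

Section LebesgueTranslation.
Context {R : realType}.
Local Notation mu := (@lebesgue_measure R).
Implicit Types (a b c : R) (g : R -> R) (A : set R).

Let measurable_shift c : measurable_fun [set: measurableTypeR R]
  (fun x : measurableTypeR R => x + c : measurableTypeR R).
Proof. by apply: measurable_funD => //; exact: measurable_cst. Qed.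

Lemma bounded_mfun_shift c g : bounded_mfun g ->
  bounded_mfun (fun x : R => g (x + c)).
Proof. by apply: bounded_mfun_comp; exact: measurable_shift. Qed.

Lemma lebesgue_measure_shift c A : measurable A ->
  mu ((fun x => x + c) @^-1` A) = mu A.
Proof.
move=> mA; apply/esym.
apply: (lebesgue_measure_unique
  (mu := pushforward mu (fun x => x + c : measurableTypeR R))) mA.
move=> _ [[a b] _ <-] /=; rewrite /pushforward.
rewrite (_ : _ @^-1` _ = [set` `]a - c, b - c]]); last first.
  by apply/seteqP; split => x /=; rewrite !in_itv/= ltrBlDr lerBrDr.
rewrite !lebesgue_measure_itv/= !lte_fin ltrD2r; case: ifP => // _.
by rewrite -!EFinD; congr EFin; ring.
Qed.

Lemma bounded_mfun_itv_integrable g a b :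
  bounded_mfun g -> mu.-integrable `[a, b] (EFin \o g).
Proof.
move=> bg; apply: bounded_mfun_integrable => //=.
by rewrite lebesgue_measure_itv/=; case: ifP => _; rewrite ?ltry// -EFinD ltry.
Qed.

Lemma Rintegral_itv_shift g a b c : bounded_mfun g ->
  \int[mu]_(x in `[a, b]) g (x + c) = \int[mu]_(x in `[a + c, b + c]) g x.
Proof.
move=> bg; congr fine.
have preim : (fun x => x + c) @^-1` [set` `[a + c, b + c]] = [set` `[a, b]].
  by apply/seteqP; split => x /=; rewrite !in_itv/= !lerD2r.
have mg : measurable_fun [set: measurableTypeR R] (EFin \o g).
  by apply/measurable_EFinP; case: bg.
rewrite -[in LHS]preim -(integral_pushforward (measurable_shift c) mg)//.
  by apply: eq_measure_integral => A mA _; exact: lebesgue_measure_shift.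
by rewrite preim; apply/bounded_mfun_itv_integrable/bounded_mfun_shift.
Qed.

Lemma ae_shift c (P : R -> Prop) :
  {ae mu, forall x, P x} -> {ae mu, forall x, P (x + c)}.
Proof.
move=> [A [mA A0 PA]]; exists ((fun x => x + c) @^-1` A); split.
- by rewrite -[X in measurable X]setTI; exact: measurable_shift.
- by rewrite -[RHS]A0; exact: lebesgue_measure_shift.
- by move=> x /PA.
Qed.

End LebesgueTranslation.

Section LebesgueAlmostEverywhere.
Context {R : realType}.
Local Notation mu := (@lebesgue_measure R).

Lemma zero_primitive_ae (g : R -> R) (a b : R) :
  mu.-integrable `[a, b] (EFin \o g) ->
  (forall x, a <= x <= b -> \int[mu]_(z in `[a, x]) g z = 0) ->
  {ae mu, forall x, a <= x <= b -> g x = 0}.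
Proof.
move=> ig prim0; pose h := g \_ `[a, b].
have ih : mu.-integrable [set: R] (EFin \o h).
  by rewrite /h -restrict_EFin; apply/integrable_restrict; rewrite // setTI.
have primh : (fun x => \int[mu]_(z in `]-oo, x]) h z) = cst 0.
  apply/funext => x /=; rewrite -Rintegral_mkcondr.
  rewrite (_ : _ `&` _ = [set` `[a, Num.min x b]]); last first.
    apply/seteqP; split => z /=; rewrite !in_itv/= le_min.
      by move=> [-> /andP[-> ->]].
    by move=> /and3P[-> -> ->].
  have [am|ma] := leP a (Num.min x b).
    by apply: prim0; rewrite am ge_min lexx orbT.
  by rewrite set_itv_ge ?Rintegral_set0// bnd_simp -ltNge.
have /FTC1Ny : forall y, mu.-integrable `]-oo, y] (EFin \o h).
  by move=> y; exact: integrableS ih.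
move=> /(_ (integrable_locally (measurable_itv _) ig)) /=; rewrite primh.
apply: filterS => x [_]; rewrite derive1_cst /h patchE => hx xab.
by rewrite hx mem_set//= in_itv.
Qed.

Lemma ae_itv_exists (P : R -> Prop) (a b : R) : a < b ->
  {ae mu, forall x, P x} -> exists2 x, a < x < b & P x.
Proof.
move=> ab aeP; apply: contrapT => noP.
have : mu.-negligible `]a, b[.
  apply: negligibleS aeP => x /=; rewrite in_itv/= => xab Px.
  by apply: noP; exists x.
move=> /negligibleP -/(_ (measurable_itv _)).
by rewrite /= lebesgue_measure_itv/= lte_fin ab -EFinD => -[]; lra.
Qed.

Lemma ae_itv_cst_unique {Y : Type} (g : R -> Y) (u v : Y) (a b : R) : a < b ->
  {ae mu, forall x, a < x < b -> g x = u} ->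
  {ae mu, forall x, a < x < b -> g x = v} -> u = v.
Proof.
move=> ab gu gv.
have : {ae mu, forall x, a < x < b -> u = v}.
  by apply: filterS2 gu gv => x gu gv xab; rewrite -gu// gv.
by move=> /(ae_itv_exists ab)[x xab]; exact.
Qed.

Lemma jump_not_locally_ae_const {Y : Type} (g : R -> Y) (u v : Y) (a x b : R) :
  a < x < b -> u <> v ->
  {ae mu, forall y, a < y < x -> g y = u} ->
  {ae mu, forall y, x < y < b -> g y = v} ->
  ~ locally_ae_const g x.
Proof.
move=> /andP[ax xb] uv gu gv [r r0 [c /negligible_outer_measure gc]].
have {}gc : {ae mu, forall y, x - r < y < x + r -> g y = c}.
  by apply: negligibleS gc => y /= /not_implyP.
apply: uv; transitivity c.
- apply: (ae_itv_cst_unique (g := g) (a := Num.max a (x - r)) (b := x)).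
  + by rewrite gt_max ax ltrBlDr ltrDl.
  + apply: filterS gu => y gy; rewrite gt_max => /andP[/andP[ay _] yx].
    by rewrite gy ?ay.
  + apply: filterS gc => y gy; rewrite gt_max => /andP[/andP[_ ry] yx].
    by rewrite gy// ry (lt_trans yx)// ltrDl.
- apply/esym/(ae_itv_cst_unique (g := g) (a := x) (b := Num.min b (x + r))).
  + by rewrite lt_min xb ltrDl.
  + apply: filterS gv => y gy; rewrite lt_min => /and3P[xy yb _].
    by rewrite gy ?xy.
  + apply: filterS gc => y gy; rewrite lt_min => /and3P[xy _ yr].
    by rewrite gy// yr andbT (lt_trans _ xy)// ltrBlDr ltrDl.
Qed.

End LebesgueAlmostEverywhere.

Section FlowsAndCuts.
Context {R : realType} (N : network R).
Hypothesis validN : valid_network N.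
Hypothesis bounded_cap : forall e, bounded_mfun (cap N e).
Implicit Types (f : 'I_(ne N) -> R -> R) (S : 'I_(nv N) -> R -> bool).
Implicit Types (v : 'I_(nv N)) (e : 'I_(ne N)) (x : R).
Local Notation T := (horizon N).
Local Notation tau := (transit N).
Local Notation mu := (@lebesgue_measure R).

Definition inflow f v x := \sum_(e | hd N e == v) f e (x - tau e).

Definition outflow f v x := \sum_(e | tl N e == v) f e x.

Definition cut_edge S e x := S (tl N e) x && ~~ S (hd N e) (x + tau e).

Definition back_edge S e x := ~~ S (tl N e) x && S (hd N e) (x + tau e).

Definition slack f S x :=
  \sum_e ((cut_edge S e x)%:R * (cap N e x - f e x) +
          (back_edge S e x)%:R * f e x).

Definition tight_at f S x : Prop := forall e,
  (cut_edge S e x -> f e x = cap N e x) /\ (back_edge S e x -> f e x = 0).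

Definition complementary f S : Prop :=
  {ae mu, forall x, 0 <= x <= T -> tight_at f S x}.

Let tau_ge0 e : 0 <= tau e. Proof. by case: validN => _ [_ []]. Qed.

Let cap_ge0 e x : 0 <= x <= T -> 0 <= cap N e x.
Proof. by case: validN => _ [_ [_]]; exact. Qed.

Section Duality.
Variables (f : 'I_(ne N) -> R -> R) (S : 'I_(nv N) -> R -> bool).
Hypotheses (flowf : is_dyn_flow N f) (cutS : is_dyn_cut N S).

Lemma flow_support e x : f e x != 0 -> 0 <= x <= T - tau e.
Proof.
by move=> fx; apply: contrapT => xT; rewrite flowf.2.1 ?eqxx in fx.
Qed.

Lemma flow_bounds e x : 0 <= x <= T -> 0 <= f e x <= cap N e x.
Proof.
move=> xT; have [->|/flow_support fx] := eqVneq (f e x) 0.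
  by rewrite lexx cap_ge0.
exact: flowf.2.2.1.
Qed.

Lemma bounded_mfun_flow e : bounded_mfun (f e).
Proof.
split; first exact: flowf.1.
have [_ [M capM]] := bounded_cap e; exists M => x.
have [->|/flow_support fx] := eqVneq (f e x) 0.
  by rewrite normr0 (le_trans _ (capM x)).
have /andP[f0 fcap] := flowf.2.2.1 _ _ fx.
by rewrite ger0_norm// (le_trans fcap)// (le_trans (ler_norm _)).
Qed.

Lemma bounded_mfun_cut v : bounded_mfun (fun x => (S v x)%:R : R).
Proof. exact: bounded_mfun_bool (cutS.1 v). Qed.

Lemma bounded_mfun_inflow v : bounded_mfun (inflow f v).
Proof.
apply: bounded_mfun_sum => e.
exact: bounded_mfun_shift (bounded_mfun_flow e).
Qed.

Lemma bounded_mfun_outflow v : bounded_mfun (outflow f v).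
Proof. by apply: bounded_mfun_sum => e; exact: bounded_mfun_flow. Qed.

Lemma flow_conservation_ae v : v != src N -> v != snk N ->
  {ae mu, forall x, 0 <= x <= T -> inflow f v x - outflow f v x = 0}.
Proof.
move=> vs vt; apply: zero_primitive_ae; last exact: flowf.2.2.2.
apply: bounded_mfun_itv_integrable.
exact: bounded_mfunB (bounded_mfun_inflow v) (bounded_mfun_outflow v).
Qed.

Lemma Rintegral_flow_arrival e (w : R -> R) : bounded_mfun w ->
  \int[mu]_(x in `[0, T]) (w x * f e (x - tau e)) =
  \int[mu]_(x in `[0, T]) (w (x + tau e) * f e x).
Proof.
move=> bw.
transitivity (\int[mu]_(x in `[- tau e, T - tau e]) (w (x + tau e) * f e x)).
  rewrite -[in LHS](addNr (tau e)) -[in LHS](subrK (tau e) T).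
  rewrite -(Rintegral_itv_shift (g := fun x => w x * f e (x - tau e))).
    by apply: eq_Rintegral => x _; rewrite addrK.
  exact: bounded_mfunM bw (bounded_mfun_shift _ (bounded_mfun_flow e)).
apply: eq_Rintegral_supp => x; rewrite mulf_eq0 negb_or => /andP[_].
move=> /flow_support /andP[x0 xT]; have tau_e := tau_ge0 e.
by rewrite /= !in_itv/=; split=> _; apply/andP; split; lra.
Qed.

Lemma weighted_conservation (w : 'I_(nv N) -> R -> R) :
  (forall v, bounded_mfun (w v)) ->
  \sum_v \int[mu]_(x in `[0, T]) (w v x * (inflow f v x - outflow f v x)) =
  \sum_e \int[mu]_(x in `[0, T])
    ((w (hd N e) (x + tau e) - w (tl N e) x) * f e x).
Proof.
move=> bw.
have barrive v e : bounded_mfun (fun x => w v x * f e (x - tau e)).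
  exact: bounded_mfunM (bw v) (bounded_mfun_shift _ (bounded_mfun_flow e)).
have bleave v e : bounded_mfun (fun x => w v x * f e x).
  exact: bounded_mfunM (bw v) (bounded_mfun_flow e).
pose arrive e := \int[mu]_(x in `[0, T]) (w (hd N e) x * f e (x - tau e)).
pose leave e := \int[mu]_(x in `[0, T]) (w (tl N e) x * f e x).
have netE v :
    \int[mu]_(x in `[0, T]) (w v x * (inflow f v x - outflow f v x)) =
    \sum_(e | hd N e == v) arrive e - \sum_(e | tl N e == v) leave e.
  under eq_Rintegral do rewrite mulrBr !mulr_sumr.
  rewrite RintegralB//; try exact/bounded_mfun_itv_integrable/bounded_mfun_sum.
  rewrite !Rintegral_sum//; try by move=> e; exact: bounded_mfun_itv_integrable.
  by congr (_ - _); apply: eq_bigr => e /eqP <-.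
rewrite (eq_bigr _ (fun v _ => netE v)) sumrB.
have sum_fibers (h : 'I_(ne N) -> 'I_(nv N)) (F : 'I_(ne N) -> R) :
    \sum_v \sum_(e | h e == v) F e = \sum_e F e.
  by rewrite [RHS](partition_big h xpredT).
rewrite !sum_fibers -sumrB; apply: eq_bigr => e _.
rewrite /arrive /leave Rintegral_flow_arrival// -RintegralB//.
- by apply: eq_Rintegral => x _; rewrite mulrBl.
- apply: bounded_mfun_itv_integrable.
  exact: bounded_mfunM (bounded_mfun_shift _ (bw _)) (bounded_mfun_flow e).
- exact: bounded_mfun_itv_integrable.
Qed.

Lemma bounded_mfun_cut_edge e : bounded_mfun (fun x => (cut_edge S e x)%:R : R).
Proof.
apply: bounded_mfun_andb; first exact: bounded_mfun_cut.
exact/bounded_mfun_negb/(bounded_mfun_shift _ (bounded_mfun_cut _)).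
Qed.

Lemma bounded_mfun_back_edge e :
  bounded_mfun (fun x => (back_edge S e x)%:R : R).
Proof.
apply: bounded_mfun_andb; first exact/bounded_mfun_negb/bounded_mfun_cut.
exact: bounded_mfun_shift (bounded_mfun_cut _).
Qed.

Let crossing e x : R := (cut_edge S e x)%:R - (back_edge S e x)%:R.

Let bounded_mfun_crossing_flow e : bounded_mfun (fun x => crossing e x * f e x).
Proof.
apply: bounded_mfunM (bounded_mfun_flow e).
exact: bounded_mfunB (bounded_mfun_cut_edge e) (bounded_mfun_back_edge e).
Qed.

Lemma flow_value_cut : flow_value N f =
  \sum_e \int[mu]_(x in `[0, T])
    (((cut_edge S e x)%:R - (back_edge S e x)%:R) * f e x).
Proof.
pose w v x : R := (~~ S v x)%:R.
have bw v : bounded_mfun (w v) by exact/bounded_mfun_negb/bounded_mfun_cut.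
have bnet v : bounded_mfun (fun x => w v x * (inflow f v x - outflow f v x)).
  apply: bounded_mfunM => //.
  exact: bounded_mfunB (bounded_mfun_inflow v) (bounded_mfun_outflow v).
have [_ [S_src [S_snk _]]] := cutS.
have <- : \sum_v \int[mu]_(x in `[0, T])
    (w v x * (inflow f v x - outflow f v x)) = flow_value N f.
  rewrite (bigD1 (snk N))//= big1 ?addr0 => [|v v_snk].
    apply: eq_Rintegral => x; rewrite inE/= in_itv/= => xT.
    by rewrite /w (S_snk x xT) mul1r.
  apply: ae_eq0_Rintegral => //.
    by apply: measurable_funTS; case: (bnet v).
  have [->|v_src] := eqVneq v (src N).
    by apply: aeW => x; rewrite /= in_itv/= => /S_src Sx; rewrite /w Sx mul0r.
  apply: filterS (flow_conservation_ae v_src v_snk) => x net0.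
  by rewrite /= in_itv/= => /net0 ->; rewrite mulr0.
rewrite weighted_conservation//; apply: eq_bigr => e _.
apply: eq_Rintegral => x _; congr (_ * _).
by rewrite /w /cut_edge /back_edge; do 2 case: (S _ _); rewrite /=; ring.
Qed.

Lemma bounded_mfun_slack : bounded_mfun (slack f S).
Proof.
apply: bounded_mfun_sum => e; apply: bounded_mfunD; apply: bounded_mfunM.
- exact: bounded_mfun_cut_edge.
- exact: bounded_mfunB (bounded_cap e) (bounded_mfun_flow e).
- exact: bounded_mfun_back_edge.
- exact: bounded_mfun_flow.
Qed.

Lemma cut_capacity_slack :
  cut_capacity N S = (flow_value N f + \int[mu]_(x in `[0, T]) slack f S x)%:E.
Proof.
pose net x := \sum_e crossing e x * f e x.
have rateE x : \sum_(e | cut_edge S e x) cap N e x = net x + slack f S x.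
  rewrite big_mkcond -big_split; apply: eq_bigr => e _ /=; rewrite /crossing.
  by case: (cut_edge S e x) => /=; ring.
have bnet : bounded_mfun net by exact: bounded_mfun_sum.
have brate := bounded_mfunD bnet bounded_mfun_slack.
rewrite /cut_capacity; under eq_integral do rewrite rateE.
rewrite -[LHS]fineK; last first.
  exact: (integrable_fin_num _ (bounded_mfun_itv_integrable _ _ brate)).
congr EFin; rewrite -[LHS]/(Rintegral _ _ _) RintegralD//; last 2 first.
- exact: bounded_mfun_itv_integrable.
- exact/bounded_mfun_itv_integrable/bounded_mfun_slack.
rewrite flow_value_cut Rintegral_sum// => e.
exact/bounded_mfun_itv_integrable/bounded_mfun_crossing_flow.
Qed.

Lemma slack_ge0 x : 0 <= x <= T -> 0 <= slack f S x.
Proof.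
move=> xT; apply: sumr_ge0 => e _; have /andP[f0 fcap] := flow_bounds e xT.
by rewrite addr_ge0// mulr_ge0// subr_ge0.
Qed.

Lemma slack_eq0 x : 0 <= x <= T -> slack f S x = 0 <-> tight_at f S x.
Proof.
move=> xT.
have term_ge0 e : 0 <= (cut_edge S e x)%:R * (cap N e x - f e x) /\
    0 <= (back_edge S e x)%:R * f e x.
  by have /andP[f0 fcap] := flow_bounds e xT; rewrite !mulr_ge0// subr_ge0.
split=> [/eqP|tight].
  rewrite psumr_eq0 => [/allP slack0 e|e _]; last first.
    by have [cut0 back0] := term_ge0 e; rewrite addr_ge0.
  have := slack0 e (mem_index_enum e); have [cut0 back0] := term_ge0 e.
  rewrite /= paddr_eq0// => /andP[/eqP cutE /eqP backE].
  split=> [ce|be]; last by rewrite be mul1r in backE.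
  by apply/esym/eqP; rewrite ce mul1r in cutE; rewrite -subr_eq0 cutE.
apply: big1 => e _; have [cut_tight back_tight] := tight e.
have [ce|_] := boolP (cut_edge S e x); have [be|_] := boolP (back_edge S e x).
- by rewrite -cut_tight// back_tight// subrr !mulr0 addr0.
- by rewrite -cut_tight// subrr mulr0 mul0r addr0.
- by rewrite back_tight// mulr0 mul0r addr0.
- by rewrite !mul0r addr0.
Qed.

Lemma weak_duality : ((flow_value N f)%:E <= cut_capacity N S)%E.
Proof.
rewrite cut_capacity_slack lee_fin lerDl; apply: Rintegral_ge0 => x.
by rewrite /= in_itv; exact: slack_ge0.
Qed.

Lemma complementaryP :
  complementary f S <-> cut_capacity N S = (flow_value N f)%:E.
Proof.
rewrite cut_capacity_slack; split=> [tight|[/eqP]].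
  rewrite ae_eq0_Rintegral ?addr0//.
    by apply: measurable_funTS; case: bounded_mfun_slack.
  apply: filterS tight => x tight_x; rewrite /= in_itv/= => xT.
  by apply/slack_eq0 => //; exact: tight_x.
rewrite -subr_eq0 addrAC subrr add0r => /eqP int0.
have : {ae mu, forall x, [set` `[0, T]] x -> slack f S x = 0}.
  apply: Rintegral_eq0_ae int0 => //.
    exact/bounded_mfun_itv_integrable/bounded_mfun_slack.
  by apply: aeW => x; rewrite /= in_itv; exact: slack_ge0.
apply: filterS => x; rewrite /= in_itv/= => slack0 xT.
by apply/slack_eq0 => //; exact: slack0.
Qed.

End Duality.

Variables (f0 : 'I_(ne N) -> R -> R) (S0 : 'I_(nv N) -> R -> bool).
Hypotheses (flow0 : is_dyn_flow N f0) (cut0 : is_dyn_cut N S0).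
Hypothesis tight0 : complementary f0 S0.

Let optimum0 : cut_capacity N S0 = (flow_value N f0)%:E.
Proof. exact/complementaryP. Qed.

Lemma complementary_min_cut S : is_min_dyn_cut N S -> complementary f0 S.
Proof.
move=> [cutS minS]; apply/complementaryP => //; apply/eqP.
by rewrite eq_le weak_duality// andbT -optimum0 minS.
Qed.

Lemma flow_value_max_flow f :
  is_max_dyn_flow N f -> flow_value N f = flow_value N f0.
Proof.
move=> [flowf maxf]; apply/eqP; rewrite eq_le maxf// andbT.
by rewrite -lee_fin -optimum0 weak_duality.
Qed.

Lemma complementary_max_flow f : is_max_dyn_flow N f -> complementary f S0.
Proof.
move=> maxf; apply/complementaryP => //; first by case: maxf.
by rewrite flow_value_max_flow.
Qed.

End FlowsAndCuts.

Section Pulse.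
Context {R : realType}.
Implicit Types (x : R) (i k : nat).

Fixpoint pulse i x : bool :=
  if i is j.+1 then pulse j x || pulse j (x - (2 ^ i)%:R) else 0 <= x < 1.

Lemma natr_exp2S i : (2 ^ i.+1)%:R = (2 ^ i)%:R + (2 ^ i)%:R :> R.
Proof. by rewrite -natrD addnn -mul2n -expnS. Qed.

Lemma pulse_bounds i x : pulse i x -> 0 <= x < (2 ^ i.+1)%:R.
Proof.
elim: i x => [|i IHi] x; first by move=> /andP[x0 x1]; apply/andP; split; lra.
have pow_gt0 : 0 < (2 ^ i.+1)%:R :> R by rewrite ltr0n expn_gt0.
by move=> /orP[] /IHi /andP[xl xr]; rewrite natr_exp2S; apply/andP; split; lra.
Qed.

Lemma pulseS i x : (pulse i.+1 x)%:R =
  (pulse i x)%:R + (pulse i (x - (2 ^ i.+1)%:R))%:R :> R.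
Proof.
rewrite /=; have [px|_] := boolP (pulse i x); last by rewrite add0r.
have [py|_] := boolP (pulse i _); last by rewrite addr0.
have /andP[_ x_lt] := pulse_bounds px; have /andP[x_ge _] := pulse_bounds py.
by exfalso; lra.
Qed.

Lemma pulse_itv i k x : (k < 2 ^ i.+1)%N -> k%:R <= x < k.+1%:R ->
  pulse i x = ~~ odd k.
Proof.
elim: i k x => [|i IHi] k x k_lt /andP[kx xk].
  by case: k k_lt kx xk => [|[|]]//= _ kx xk; apply/idP/idP => //; lra.
have pulse_early y : y < 0 -> pulse i y = false.
  by move=> y0; apply: contraTF y0 => /pulse_bounds/andP[]; rewrite -leNgt.
have pulse_late y : (2 ^ i.+1)%:R <= y -> pulse i y = false.
  by move=> yp; apply: contraTF yp => /pulse_bounds/andP[_]; rewrite -ltNge.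
rewrite /=; have [k_small|k_big] := ltnP k (2 ^ i.+1).
  rewrite (IHi k) ?kx// pulse_early ?orbF//.
  by rewrite subr_lt0 (lt_le_trans xk)// ler_nat.
rewrite pulse_late /=; last by rewrite (le_trans _ kx)// ler_nat.
rewrite (IHi (k - 2 ^ i.+1)%N).
- by rewrite oddB// oddX addbF.
- by move: k_lt; rewrite (expnS _ i.+1); lia.
- by rewrite -subSn// !natrB ?leqW// lerD2r kx ltrD2r.
Qed.

Lemma measurable_pulse i : measurable [set x | pulse i x].
Proof.
elim: i => [|i IHi].
  rewrite (_ : [set x | _] = [set` `[0 : R, 1[]); first exact: measurable_itv.
  by apply/seteqP; split => x /=; rewrite in_itv.
rewrite (_ : [set x | _] = [set x | pulse i x] `|`
    (fun x => x - (2 ^ i.+1)%:R) @^-1` [set x | pulse i x]); last first.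
  by apply/seteqP; split => x /= /orP.
apply: measurableU => //; rewrite -[X in measurable X]setTI.
by apply: measurable_funB => //; exact: measurable_cst.
Qed.

Lemma bounded_mfun_pulse i : bounded_mfun (fun x => (pulse i x)%:R : R).
Proof. by apply: bounded_mfun_bool; exact: measurable_pulse. Qed.

Lemma ae_eq_pulse_jump {Y : Type} (g : R -> Y) (h : bool -> Y) i j :
  h true <> h false ->
  {ae lebesgue_measure, forall x, 0 <= x <= (2 ^ i.+1)%:R ->
    g x = h (pulse i x)} ->
  (j < 2 ^ i)%N -> ~ locally_ae_const g j.*2.+1%:R.
Proof.
move=> h_inj gE j_lt.
have gk k : (k < 2 ^ i.+1)%N -> {ae lebesgue_measure, forall x : R,
    k%:R < x < k.+1%:R -> g x = h (~~ odd k)}.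
  move=> k_lt; apply: filterS gE => x gx /andP[kx xk].
  rewrite gx ?(pulse_itv k_lt) ?(ltW kx)//; apply/andP; split.
    by rewrite (le_trans _ (ltW kx)).
  by rewrite (le_trans (ltW xk))// ler_nat.
have j2_lt : (j.*2.+1 < 2 ^ i.+1)%N by rewrite expnS; lia.
apply: (jump_not_locally_ae_const (a := j.*2%:R) (b := j.*2.+2%:R) _ h_inj).
- by rewrite !ltr_nat !ltnSn.
- by have := gk _ (ltnW j2_lt); rewrite odd_double.
- by have := gk _ j2_lt; rewrite /= odd_double.
Qed.

Lemma complexity_ge_odd_times (A : eqType) (a : A) (change : A -> R -> Prop) n :
  (forall j, (j < n)%N -> change a j.*2.+1%:R) ->
  exists s : seq (A * R), uniq s /\ (n <= size s)%N /\
    forall p, p \in s -> change p.1 p.2.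
Proof.
move=> changes; exists [seq (a, j.*2.+1%:R) | j <- iota 0 n]; split; [|split].
- rewrite map_inj_uniq ?iota_uniq// => i j [] /eqP.
  by rewrite eqr_nat eqSS => /eqP/double_inj.
- by rewrite size_map size_iota.
- by move=> _ /mapP[j + ->]; rewrite mem_iota => /changes.
Qed.

End Pulse.

Section PulseNetwork.
Context (R : realType) (l : nat).
Local Notation T := ((2 ^ l.+1)%:R : R).
Local Notation mu := (@lebesgue_measure R).

Definition large_cap : R := (2 ^ l).+1%:R.

(* Vertex 0 is s, vertex i.+1 is v_i and vertex l.+2 is t.  Edge 0 is s -> v_0,
   edges i.*2.+1 and i.*2.+2 both join v_i to v_(i+1), and edge l.*2.+1 is
   v_l -> t. *)
Definition pulse_network : network R :=
  @Network R l.+3 l.*2.+2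
    (fun e => inord (uphalf e)) (fun e => inord (uphalf e).+1)
    (inord 0) (inord l.+2) T
    (fun e => if odd e || (e == 0 :> nat) then 0 else (2 ^ e./2)%:R)
    (fun e x => if e == 0 :> nat then (if x < 1 then large_cap else 0)
                else if e == l.*2.+1 :> nat then 1 else large_cap).

Local Notation N := pulse_network.

Definition vertex (m : nat) : 'I_(nv N) := inord m.

Definition entry : 'I_(ne N) := inord 0.

Definition link (b : bool) (m : nat) : 'I_(ne N) := inord (m.*2 + b).+1.

Definition exit : 'I_(ne N) := inord l.*2.+1.

Variant edge_spec : 'I_(ne N) -> Prop :=
  | EntryEdge : edge_spec entry
  | LinkEdge b m of (m < l)%N : edge_spec (link b m)
  | ExitEdge : edge_spec exit.

Lemma edgeP e : edge_spec e.
Proof.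
case: e => [[|k] /= k_lt].
  rewrite (_ : Ordinal k_lt = entry); first exact: EntryEdge.
  by apply/val_inj; rewrite /= inordK.
have [k_last|k_inner] := eqVneq k l.*2.
  rewrite (_ : Ordinal k_lt = exit); first exact: ExitEdge.
  by apply/val_inj; rewrite /= inordK; lia.
rewrite (_ : Ordinal k_lt = link (odd k) k./2); first by apply: LinkEdge; lia.
by apply/val_inj; rewrite /= inordK; lia.
Qed.

Lemma val_vertex m : (m < l.+3)%N -> vertex m = m :> nat.
Proof. exact: inordK. Qed.

Lemma eq_vertex m k : (m < l.+3)%N -> (k < l.+3)%N ->
  (vertex m == vertex k) = (m == k).
Proof. by move=> m_lt k_lt; rewrite -val_eqE /= !inordK. Qed.

Lemma entryE : ((tl N entry = vertex 0) * (hd N entry = vertex 1) *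
  (transit N entry = 0) *
  (forall x, cap N entry x = if x < 1 then large_cap else 0))%type.
Proof. by rewrite /= /entry inordK. Qed.

Lemma linkE b m : (m < l)%N -> ((tl N (link b m) = vertex m.+1) *
  (hd N (link b m) = vertex m.+2) *
  (transit N (link b m) = if b then (2 ^ m.+1)%:R else 0) *
  (forall x, cap N (link b m) x = large_cap))%type.
Proof.
move=> ml; rewrite /= /link inordK; last by lia.
rewrite (_ : uphalf _ = m.+1); last by lia.
rewrite (_ : (_ == l.*2.+1) = false); last by lia.
rewrite orbF (_ : odd _ = ~~ b); last by lia.
rewrite (_ : _./2 = (m + b)%N); last by lia.
by case: b; rewrite ?addn1.
Qed.

Lemma exitE : ((tl N exit = vertex l.+1) * (hd N exit = vertex l.+2) *
  (transit N exit = 0) * (forall x, cap N exit x = 1))%type.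
Proof.
rewrite /= /exit inordK// (_ : uphalf _ = l.+1); last by lia.
by rewrite [odd _]/= odd_double eqxx.
Qed.

Definition edgeE := (entryE, exitE, linkE).

Lemma inner_vertexP v : v != src N -> v != snk N ->
  exists2 m, (m <= l)%N & v = vertex m.+1.
Proof.
rewrite -!val_eqE /= !inordK//; case: v => [[|m] /= m_lt] //= _ v_snk.
exists m; first by lia.
by apply/val_inj; rewrite /= inordK.
Qed.

Lemma pulse_network_valid : valid_network N.
Proof.
split; first by rewrite eq_vertex.
split; first exact: ler0n.
split=> [e|e x _].
  by case: (edgeP e) => [|[] m ml|]; rewrite edgeE ?ler0n ?lexx.
case: (edgeP e) => [|b m ml|]; rewrite edgeE ?ler0n//.
by case: ifP => _; rewrite ?ler0n ?lexx.
Qed.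

Lemma lt_tl_hd e : (tl N e < hd N e)%N.
Proof. by rewrite /= !inordK//; case: e => k /= k_lt; lia. Qed.

Lemma pulse_network_acyclic : acyclic_network N.
Proof.
move=> e0 p path_p.
suff : (tl N e0 < hd N (last e0 p))%N by apply: contraTneq => ->; rewrite ltnn.
elim: p e0 path_p => [|e p IHp] e0; first by move=> _; exact: lt_tl_hd.
by move=> /andP[/eqP hd_e0 /IHp]; apply: ltn_trans; rewrite -hd_e0 lt_tl_hd.
Qed.

Lemma pulse_network_one_change :
  exists (e0 : 'I_(ne N)) (theta0 a b delta : R),
    one_capacity_change_at N e0 theta0 a b /\ 0 < delta /\
    integer_multiple delta (horizon N) /\
    (forall e, integer_multiple delta (transit N e)) /\
    integer_multiple delta theta0.
Proof.
exists entry, 1, large_cap, 0, 1; split; last (split=> //; split; last split).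
- split; first by rewrite ltr01 ltr1n expnS; have := expn_gt0 2 l; lia.
  split; first by rewrite gt_eqF// ltr0n.
  split=> [x|e]; first by rewrite entryE.
  case: (edgeP e) => [|b m ml|] e_neq; first by rewrite eqxx in e_neq.
  + by exists large_cap => x; rewrite linkE.
  + by exists 1 => x; rewrite exitE.
- by exists (2 ^ l.+1)%N; rewrite mulr1.
- move=> e; case: (edgeP e) => [|[] m ml|]; rewrite edgeE//.
  + by exists 0; rewrite mul0r.
  + by exists (2 ^ m.+1)%N; rewrite mulr1.
  + by exists 0; rewrite mul0r.
  + by exists 0; rewrite mul0r.
- by exists 1; rewrite mulr1.
Qed.

Lemma bounded_mfun_cap e : bounded_mfun (cap N e).
Proof.
have const_cap e' r : (forall x, cap N e' x = r) -> bounded_mfun (cap N e').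
  by move=> /funext ->; exact: bounded_mfun_cst.
case: (edgeP e) => [|b m ml|]; last 2 first.
- by apply: const_cap => x; rewrite linkE.
- by apply: const_cap => x; rewrite exitE.
rewrite (_ : cap N entry = fun x => large_cap * (x < 1)%R%:R).
  apply: bounded_mfunM; first exact: bounded_mfun_cst.
  apply: bounded_mfun_bool.
  rewrite (_ : [set x | _] = [set` `]-oo, 1[]); first exact: measurable_itv.
  by apply/seteqP; split => x /=; rewrite in_itv.
by apply/funext => x; rewrite entryE; case: ifP; rewrite ?mulr1 ?mulr0.
Qed.

Lemma sum_tl m (F : 'I_(ne N) -> R) : (m < l.+3)%N ->
  \sum_(e | tl N e == vertex m) F e = \sum_(e < l.*2.+2 | uphalf e == m) F e.
Proof.
move=> m_lt; apply: eq_bigl => e; rewrite /= eq_vertex//.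
by case: e => k /= k_lt; lia.
Qed.

Lemma sum_hd m (F : 'I_(ne N) -> R) : (m < l.+2)%N ->
  \sum_(e | hd N e == vertex m.+1) F e = \sum_(e < l.*2.+2 | uphalf e == m) F e.
Proof.
move=> m_lt; apply: eq_bigl => e; rewrite /= eq_vertex//.
by case: e => k /= k_lt; lia.
Qed.

Lemma sum_entry (F : 'I_(ne N) -> R) :
  \sum_(e < l.*2.+2 | uphalf e == 0) F e = F entry.
Proof.
apply: big_pred1 => e; rewrite /= -val_eqE /= inordK//.
by case: e => k /= k_lt; lia.
Qed.

Lemma sum_link m (F : 'I_(ne N) -> R) : (m < l)%N ->
  \sum_(e < l.*2.+2 | uphalf e == m.+1) F e =
  F (link false m) + F (link true m).
Proof.
move=> ml.
have link_lt (b : bool) : ((m.*2 + b).+1 < l.*2.+2)%N by case: b; lia.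
rewrite (bigD1 (link false m)) /=; last by rewrite inordK//; lia.
rewrite (big_pred1 (link true m))// => e /=; rewrite -!val_eqE /= !inordK//.
by case: e => k /= k_lt; lia.
Qed.

Lemma sum_exit (F : 'I_(ne N) -> R) :
  \sum_(e < l.*2.+2 | uphalf e == l.+1) F e = F exit.
Proof.
apply: big_pred1 => e; rewrite /= -val_eqE /= inordK//.
by case: e => k /= k_lt; lia.
Qed.

Lemma pulse_horizon i (x : R) : (i <= l)%N -> pulse i x -> 0 <= x <= T.
Proof.
move=> il /pulse_bounds/andP[-> xi]; rewrite (le_trans (ltW xi))//.
by rewrite ler_nat leq_exp2l.
Qed.

(* For i < l, v_i splits its inflow evenly over the two edges to v_(i+1). *)
Definition pulse_flow (e : 'I_(ne N)) (x : R) : R :=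
  (2 ^ (l - uphalf e))%:R * (pulse (uphalf e).-1 x)%:R.

Definition pulse_cut (v : 'I_(nv N)) (x : R) : bool :=
  [|| T < x, v == vertex 0 | (v != vertex l.+2) && pulse v.-1 x].

Lemma pulse_flow_entry x : pulse_flow entry x = (2 ^ l)%:R * (pulse 0 x)%:R.
Proof. by rewrite /pulse_flow inordK// subn0. Qed.

Lemma pulse_flow_link b m x : (m < l)%N ->
  pulse_flow (link b m) x = (2 ^ (l - m.+1))%:R * (pulse m x)%:R.
Proof.
move=> ml; rewrite /pulse_flow inordK; last by lia.
by rewrite (_ : uphalf _ = m.+1)//; lia.
Qed.

Lemma pulse_flow_exit x : pulse_flow exit x = (pulse l x)%:R.
Proof.
rewrite /pulse_flow inordK// (_ : uphalf _ = l.+1); last by lia.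
by rewrite (_ : (l - l.+1 = 0)%N) ?mul1r//; lia.
Qed.

Definition pulse_flowE := (pulse_flow_entry, pulse_flow_exit, pulse_flow_link).

Lemma pulse_cut_src x : pulse_cut (vertex 0) x.
Proof. by rewrite /pulse_cut eqxx orbT. Qed.

Lemma pulse_cut_late v x : T < x -> pulse_cut v x.
Proof. by rewrite /pulse_cut => ->. Qed.

Lemma pulse_cut_snk x : x <= T -> pulse_cut (vertex l.+2) x = false.
Proof. by move=> xT; rewrite /pulse_cut ltNge xT eq_vertex// eqxx. Qed.

Lemma pulse_cut_inner m x : (m <= l)%N -> x <= T ->
  pulse_cut (vertex m.+1) x = pulse m x.
Proof.
move=> ml xT; have m_lt : (m.+1 < l.+3)%N by lia.
rewrite /pulse_cut ltNge xT !eq_vertex// val_vertex//.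
by rewrite (_ : (m.+1 != l.+2)%N)//; lia.
Qed.

Lemma pulse_outflow m x : (m <= l)%N ->
  outflow pulse_flow (vertex m.+1) x = (2 ^ (l - m))%:R * (pulse m x)%:R.
Proof.
rewrite /outflow leq_eqVlt => /predU1P[->|ml].
  by rewrite sum_tl// sum_exit pulse_flowE subnn mul1r.
rewrite sum_tl; last by lia.
by rewrite sum_link// !pulse_flowE// -mulrDl -natr_exp2S -subSn.
Qed.

Lemma pulse_inflow m x : (m <= l)%N ->
  inflow pulse_flow (vertex m.+1) x = (2 ^ (l - m))%:R * (pulse m x)%:R.
Proof.
move=> ml; rewrite /inflow sum_hd; last by lia.
case: m ml => [_|m ml].
  by rewrite sum_entry edgeE subr0 pulse_flowE subn0.
by rewrite sum_link// !edgeE// !pulse_flowE// subr0 -mulrDr pulseS.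
Qed.

Lemma bounded_mfun_pulse_flow e : bounded_mfun (pulse_flow e).
Proof.
apply: bounded_mfunM; first exact: bounded_mfun_cst.
exact: bounded_mfun_pulse.
Qed.

Lemma pulse_flow_support e x : pulse_flow e x != 0 -> 0 <= x <= T - transit N e.
Proof.
have scaled_pulse r i : r * (pulse i x)%:R != 0 :> R -> pulse i x.
  by case: (pulse i x) => //; rewrite mulr0 eqxx.
case: (edgeP e) => [|[] m ml|]; rewrite !edgeE// pulse_flowE//.
- by rewrite subr0 => /scaled_pulse/pulse_horizon; exact.
- move=> /scaled_pulse/pulse_bounds/andP[-> /ltW x_le]; rewrite lerBrDr.
  rewrite (le_trans (lerD x_le (lexx _)))// -natr_exp2S.
  by rewrite ler_nat leq_exp2l.
- by rewrite subr0 => /scaled_pulse/pulse_horizon; apply; exact: ltnW.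
- by rewrite subr0 -[_%:R]mul1r => /scaled_pulse/pulse_horizon; exact.
Qed.

Lemma pulse_flow_ge0 e x : 0 <= pulse_flow e x.
Proof. by rewrite mulr_ge0. Qed.

Lemma scaled_pulse_lt_large_cap k i (x : R) : (k <= l)%N ->
  (2 ^ k)%:R * (pulse i x)%:R < large_cap.
Proof.
move=> kl; case: (pulse i x); rewrite ?mulr1 ?mulr0 ?ltr0n//.
by rewrite ltr_nat ltnS leq_exp2l.
Qed.

Lemma pulse_flow_le_cap e x : pulse_flow e x <= cap N e x.
Proof.
case: (edgeP e) => [|b m ml|]; rewrite !edgeE// pulse_flowE//.
- have [x1|x1] := ltP x 1; first by rewrite ltW// scaled_pulse_lt_large_cap.
  by rewrite /= [x < 1]ltNge x1 andbF mulr0.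
- by rewrite ltW// scaled_pulse_lt_large_cap// leq_subr.
- by case: (pulse l x).
Qed.

Lemma pulse_flow_is_dyn_flow : is_dyn_flow N pulse_flow.
Proof.
split; [|split; [|split]].
- by move=> e; case: (bounded_mfun_pulse_flow e).
- by move=> e x; apply: contra_notP => /eqP; exact: pulse_flow_support.
- by move=> e x _; rewrite pulse_flow_ge0 pulse_flow_le_cap.
- move=> v vs vt Th _; have [m ml ->] := inner_vertexP vs vt.
  transitivity (\int[mu]_(x in `[0, Th]) (0 : R)).
    apply: eq_Rintegral => x _; rewrite -/(inflow _ _ x) -/(outflow _ _ x).
    by rewrite pulse_inflow// pulse_outflow// subrr.
  by rewrite Rintegral_cst// mul0r.
Qed.

Lemma pulse_cut_is_dyn_cut : is_dyn_cut N pulse_cut.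
Proof.
split; [|split; [|split]].
- move=> v; rewrite (_ : [set x | _] = [set` `]T, +oo[] `|` [set x |
      (v == vertex 0) || (v != vertex l.+2) && pulse v.-1 x]); last first.
    by apply/seteqP; split => x /=; rewrite in_itv/= andbT => /orP.
  apply: measurableU => //; case: eqP => _; last case: eqP => _ /=.
  + by rewrite (_ : [set x | _] = setT)//; apply/seteqP; split.
  + by rewrite (_ : [set x | _] = set0)//; apply/seteqP; split.
  + exact: measurable_pulse.
- by move=> x _; exact: pulse_cut_src.
- by move=> x /andP[_ xT]; rewrite pulse_cut_snk.
- by move=> v x; exact: pulse_cut_late.
Qed.

Lemma pulse_flow_cut_complementary : complementary pulse_flow pulse_cut.
Proof.
apply: aeW => x /andP[x0 xT] e; rewrite /cut_edge /back_edge.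
have pulse_cut_link b m : (m < l)%N -> pulse m x ->
    pulse_cut (vertex m.+2) (x + if b then (2 ^ m.+1)%:R else 0).
  move=> ml px; set y := x + _.
  have [late|early] := ltP T y; first exact: pulse_cut_late.
  rewrite pulse_cut_inner// /y /=.
  by case: b {y early}; rewrite ?addrK ?addr0 px ?orbT.
case: (edgeP e) => [|b m ml|]; rewrite !edgeE// pulse_flowE//.
- rewrite pulse_cut_src addr0 pulse_cut_inner//=; split=> //.
  by rewrite x0 /= => /negbTE ->; rewrite mulr0.
- rewrite pulse_cut_inner ?(ltnW ml)//; split=> /andP[].
    by move=> /(pulse_cut_link b _ ml) ->.
  by move=> /negbTE -> _; rewrite mulr0.
- by rewrite addr0 pulse_cut_inner// pulse_cut_snk// andbT andbF; split=> // ->.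
Qed.

Lemma flow_value_exit g : flow_value N g = \int[mu]_(x in `[0, T]) g exit x.
Proof.
apply: eq_Rintegral => x _; rewrite -/(inflow _ _ x) -/(outflow _ _ x).
rewrite /inflow /outflow sum_hd// sum_exit sum_tl// edgeE subr0.
by rewrite big_pred0 ?subr0// => e; case: e => k /= k_lt; lia.
Qed.

Section MinCut.
Variable S : 'I_(nv N) -> R -> bool.
Hypothesis minS : is_min_dyn_cut N S.

Let tight : complementary pulse_flow S.
Proof.
exact: (complementary_min_cut pulse_network_valid bounded_mfun_cap
  pulse_flow_is_dyn_flow pulse_cut_is_dyn_cut pulse_flow_cut_complementary).
Qed.

Lemma min_cut_unsaturated : {ae mu, forall x, 0 <= x <= T -> forall e,
  pulse_flow e x < cap N e x -> S (tl N e) x -> S (hd N e) (x + transit N e)}.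
Proof.
apply: filterS tight => x tight_x xT e + Stl; apply: contraLR => Shd.
by rewrite -leNgt (tight_x xT e).1// /cut_edge Stl.
Qed.

Lemma min_cut_contains_pulse m : (m <= l)%N ->
  {ae mu, forall x, pulse m x -> S (vertex m.+1) x}.
Proof.
elim: m => [_|m IHm ml].
  apply: filterS min_cut_unsaturated => x uncut px.
  have xT := pulse_horizon (leq0n l) px; have := uncut xT entry.
  rewrite !edgeE addr0; apply; last exact: minS.1.2.1.
  by case/andP: px => _ ->; rewrite pulse_flowE scaled_pulse_lt_large_cap.
have Sm := IHm (ltnW ml).
have S_link b : {ae mu, forall x, pulse m x ->
    S (vertex m.+2) (x + if b then (2 ^ m.+1)%:R else 0)}.
  apply: filterS2 min_cut_unsaturated Sm => x uncut Sx px.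
  have := uncut (pulse_horizon (ltnW ml) px) (link b m).
  rewrite !edgeE// pulse_flowE//; apply; last exact: Sx.
  by rewrite scaled_pulse_lt_large_cap// leq_subr.
apply: filterS2 (S_link false) (ae_shift (- (2 ^ m.+1)%:R) (S_link true)).
move=> x S_direct S_delayed /orP[/S_direct|/S_delayed]; first by rewrite addr0.
by rewrite subrK.
Qed.

Lemma min_cut_pulse :
  {ae mu, forall x, 0 <= x <= T -> S (vertex l.+1) x = pulse l x}.
Proof.
apply: filterS2 tight (min_cut_contains_pulse (leqnn l)) => x tight_x Spulse xT.
apply/idP/idP => // Sx; have := (tight_x xT exit).1.
rewrite /cut_edge !edgeE addr0 pulse_flowE Sx (minS.1.2.2.1 x xT) => /(_ isT).
by case: (pulse l x) => // /eqP; rewrite eq_sym oner_eq0.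
Qed.

Lemma min_cut_complexity : cut_complexity_ge N S (2 ^ l).
Proof.
apply: (complexity_ge_odd_times (a := vertex l.+1)) => j j_lt.
split; first exact: ltr0n.
by apply: (ae_eq_pulse_jump (h := id) (i := l)) => //; exact: min_cut_pulse.
Qed.

End MinCut.

Section MaxFlow.
Variable f : 'I_(ne N) -> R -> R.
Hypothesis maxf : is_max_dyn_flow N f.

Let tight : complementary f pulse_cut.
Proof.
exact: (complementary_max_flow pulse_network_valid bounded_mfun_cap
  pulse_flow_is_dyn_flow pulse_cut_is_dyn_cut pulse_flow_cut_complementary).
Qed.

Let value_f : flow_value N f = flow_value N pulse_flow.
Proof.
exact: (flow_value_max_flow pulse_network_valid bounded_mfun_cap
  pulse_flow_is_dyn_flow pulse_cut_is_dyn_cut pulse_flow_cut_complementary).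
Qed.

Lemma max_flow_ge_pulse :
  {ae mu, forall x, 0 <= x <= T -> pulse l x -> f exit x = 1}.
Proof.
apply: filterS tight => x tight_x xT px; have /andP[_ xT'] := xT.
have := (tight_x xT exit).1; rewrite /cut_edge !edgeE; apply.
by rewrite addr0 pulse_cut_inner// pulse_cut_snk// px.
Qed.

Lemma max_flow_pulse :
  {ae mu, forall x, 0 <= x <= T -> f exit x = (pulse l x)%:R}.
Proof.
have bf : bounded_mfun (f exit).
  by apply: (bounded_mfun_flow bounded_mfun_cap); case: maxf.
have bp := @bounded_mfun_pulse R l.
have int0 : \int[mu]_(x in `[0, T]) (f exit x - (pulse l x)%:R) = 0.
  rewrite RintegralB//; try exact: bounded_mfun_itv_integrable.
  rewrite -flow_value_exit value_f flow_value_exit.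
  under eq_Rintegral do rewrite pulse_flow_exit.
  by rewrite subrr.
have : {ae mu, forall x, [set` `[0, T]] x -> f exit x - (pulse l x)%:R = 0}.
  apply: Rintegral_eq0_ae int0 => //.
    exact/bounded_mfun_itv_integrable/bounded_mfunB.
  apply: filterS max_flow_ge_pulse => x f1; rewrite /= in_itv/= => xT.
  have [px|_] := boolP (pulse l x); first by rewrite f1// subrr.
  rewrite subr0.
  by have /andP[] := flow_bounds pulse_network_valid maxf.1 exit xT.
by apply: filterS => x fx xT; apply/eqP; rewrite -subr_eq0 fx.
Qed.

Lemma max_flow_complexity : flow_complexity_ge N f (2 ^ l).
Proof.
apply: (complexity_ge_odd_times (a := exit)) => j j_lt; split.
  by rewrite edgeE subr0 ltr0n ltr_nat expnS; lia.
apply: (ae_eq_pulse_jump (h := fun b : bool => b%:R) (i := l)) => //.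
  by apply/eqP; rewrite oner_eq0.
exact: max_flow_pulse.
Qed.

End MaxFlow.

End PulseNetwork.

Theorem theorem4 (R : realType) :
  exists c k : nat, forall l : nat, (0 < l)%N ->
    exists N : network R,
      (nv N + ne N <= c * l ^ k)%N /\
      valid_network N /\
      acyclic_network N /\
      (exists (e0 : 'I_(ne N)) (theta0 a b delta : R),
         one_capacity_change_at N e0 theta0 a b /\
         0 < delta /\
         integer_multiple delta (horizon N) /\
         (forall e, integer_multiple delta (transit N e)) /\
         integer_multiple delta theta0) /\
      (forall S, is_min_dyn_cut N S -> cut_complexity_ge N S (2 ^ l)) /\
      (forall f, is_max_dyn_flow N f -> flow_complexity_ge N f (2 ^ l)).
Proof.
exists 8%N, 1%N => l l_gt0; exists (pulse_network R l).
split; first by rewrite /= expn1; lia.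
split; first exact: pulse_network_valid.
split; first exact: pulse_network_acyclic.
split; first exact: pulse_network_one_change.
by split; [exact: min_cut_complexity | exact: max_flow_complexity].
Qed.
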